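(* Let $\mathcal{F}:\mathcal{C}\to\mathcal{A}$ be a bifunctor with $\mathcal{F}(pt)=\mathcal{R}$ a commutative ring with unit, and let $\chi_{\mathcal{F}}$ be the $\mathcal{F}$-characteristic (all as in the context). (i) For a proalgebraic variety $X_\infty=\varprojlim_{\lambda\in\Lambda}\{X_\lambda,\pi_{\lambda\mu}:X_\mu\to X_\lambda\}$ and a projective system $P=\{p_{\lambda\mu}\}$ of non-zero elements of $\mathcal{R}$, the homomorphisms $\chi_{\mathcal{F}}:\mathcal{F}_P^{\mathrm{st}}(X_\lambda)\to\mathcal{R}$ induce, by passing to inductive limits, a homomorphism $$\chi_{\mathcal{F}}^{\mathrm{ind}}:\mathcal{F}_P^{\mathrm{st.ind}}(X_\infty)\to\varinjlim_{\lambda\in\Lambda}\{\times p_{\lambda\mu}:\mathcal{R}\to\mathcal{R}\}.$$ (ii) In the case $\Lambda=\mathbb{N}$, for a proalgebraic variety $X_\infty=\varprojlim_{n\in\mathbb{N}}\{X_n,\pi_{nm}:X_m\to X_n\}$ and a projective system $P=\{p_{nm}\}$ of non-zero elements of $\mathcal{R}$, the homomorphism $\chi_{\mathcal{F}}^{\mathrm{ind}}:\mathcal{F}_P^{\mathrm{st.ind}}(X_\infty)\to\varinjlim_n\{\times p_{nm}:\mathcal{R}\to\mathcal{R}\}$ is realized as the (well-defined) homomorphism $$\widetilde{\chi_{\mathcal{F}}^{\mathrm{ind}}}:\mathcal{F}_P^{\mathrm{st.ind}}(X_\infty)\to\mathcal{R}_P,\qquad \widetilde{\chi_{\mathcal{F}}^{\mathrm{ind}}}([\alpha_n]):=\frac{\chi_{\mathcal{F}}(\alpha_n)}{p_{01}\cdot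 p_{12}\cdot p_{23}\cdots p_{(n-1)n}}\quad(\alpha_n\in\mathcal{F}_P^{\mathrm{st}}(X_n)),$$ where $p_{01}:=1$ and $\mathcal{R}_P$ is the ring of fractions $\mathcal{R}_S$ of $\mathcal{R}$ with respect to the multiplicatively closed set $S$ consisting of all finite products of powers of elements of $P$. (iii) In particular, when $\Lambda=\mathbb{N}$ and the projective system consists of powers of a single non-zero element $p\in\mathcal{R}$, namely $p_{nm}=p^{m-n}$ for $n\le m$, one gets the homomorphism $$\widetilde{\chi_{\mathcal{F}}^{\mathrm{ind}}}:\mathcal{F}_P^{\mathrm{st.ind}}(X_\infty)\to\mathcal{R}\left[\tfrac1p\right],\qquad \widetilde{\chi_{\mathcal{F}}^{\mathrm{ind}}}([\alpha_n]):=\frac{\chi_{\mathcal{F}}(\alpha_n)}{p^{n-1}},$$ where $\mathcal{R}[\frac1p]$ is the ring generated over $\mathcal{R}$ by the $\frac1{p^s}$ (the ring of fractions of $\mathcal{R}$ with respect to the powers of $p$).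
   Context: $\mathcal{C}$ is a category of complex algebraic varieties having a final object $pt$, and $\mathcal{A}$ is the category of abelian groups. A bifunctor $\mathcal{F}:\mathcal{C}\to\mathcal{A}$ is a pair $(\mathcal{F}_*,\mathcal{F}^* )$ of a covariant functor $\mathcal{F}_*$ and a contravariant functor $\mathcal{F}^*$ with $\mathcal{F}_*(X)=\mathcal{F}^*(X)=:\mathcal{F}(X)$ for every object $X$; for a morphism $f$ write $f_*=\mathcal{F}_*(f)$ and $f^*=\mathcal{F}^*(f)$. It is assumed that $\mathcal{F}(pt)$ is (the additive group of) a commutative ring $\mathcal{R}$ with unit. For $\pi_X:X\to pt$ the unique morphism, the $\mathcal{F}$-characteristic is the homomorphism $\chi_{\mathcal{F}}:=(\pi_X)_*:\mathcal{F}(X)\to\mathcal{F}(pt)=\mathcal{R}$. $\Lambda$ is a directed set. A proalgebraic variety $X_\infty=\varprojlim_{\lambda\in\Lambda}\{X_\lambda,\pi_{\lambda\mu}:X_\mu\to X_\lambda\ (\lambda<\mu)\}$ is the projective limit of a projective system in $\mathcal{C}$ ($\pi_{\lambda\mu}\circ\pi_{\mu\nu}=\pi_{\lambda\nu}$ for $\lambda<\mu<\nu$); the limit need not lie in $\mathcal{C}$, and the constructions below depend on the given projective system. A projective system $P=\{p_{\lambda\mu}\}$ of elements of $\mathcal{R}$ is a family with $p_{\lambda\lambda}=1$ and $p_{\lambda\mu}\cdot p_{\mu\nu}=p_{\lambda\nu}$ for $\lambda<\mu<\nu$. Put $$\mathcal{F}_P^{\mathrm{st}}(X_\lambda):=\{\alpha_\lambda\in\mathcal{F}(X_\lambda)\mid\chi_{\mathcal{F}}(\pi_{\lambda\mu}^*\alpha_\lambda)=p_{\lambda\mu}\cdot\chi_{\mathcal{F}}(\alpha_\lambda)\text{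 for every }\mu\text{ with }\lambda<\mu\}.$$ The maps $\pi_{\lambda\mu}^*$ restrict to $\mathcal{F}_P^{\mathrm{st}}(X_\lambda)\to\mathcal{F}_P^{\mathrm{st}}(X_\mu)$, and $\mathcal{F}_P^{\mathrm{st.ind}}(X_\infty)$ denotes the inductive limit of the system $\{\mathcal{F}_P^{\mathrm{st}}(X_\lambda),\pi_{\lambda\mu}^*\}$; $[\alpha_\lambda]$ denotes the class of $\alpha_\lambda$. The inductive limit $\varinjlim_{\lambda\in\Lambda}\{\times p_{\lambda\mu}:\mathcal{R}\to\mathcal{R}\}$ is that of the system with all terms equal to $\mathcal{R}$ and transition map from index $\lambda$ to index $\mu$ equal to multiplication by $p_{\lambda\mu}$. $\mathbb{N}=\{1,2,3,\dots\}$. In (ii), ''realized as'' means: $\widetilde{\chi_{\mathcal{F}}^{\mathrm{ind}}}$ is the composite of $\chi_{\mathcal{F}}^{\mathrm{ind}}$ with the canonical homomorphism $\varinjlim_n\{\times p_{nm}:\mathcal{R}\to\mathcal{R}\}\to\mathcal{R}_P$ sending the class of $r$ in the $n$-th copy of $\mathcal{R}$ to $r/(p_{01}p_{12}\cdots p_{(n-1)n})$. *)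

(* Defs.v *)
From HB Require Import structures.
From mathcomp Require Import all_boot all_order all_algebra.
From mathcomp Require Import generic_quotient.
From mathcomp Require Import boolp ring.

Set Implicit Arguments.
Unset Strict Implicit.
Unset Printing Implicit Defensive.

Import Order.Theory GRing.Theory.
Local Open Scope ring_scope.
Local Open Scope quotient_scope.

(* A category of complex algebraic varieties is used below only through its
   objects, morphisms and final object. *)
Record category := Category {
  ob :> Type;
  catHom : ob -> ob -> Type;
  catId : forall X, catHom X X;
  catComp : forall X Y Z, catHom Y Z -> catHom X Y -> catHom X Z;
  comp1m : forall X Y (f : catHom X Y), catComp (catId Y) f = f;
  compm1 : forall X Y (f : catHom X Y), catComp f (catId X) = f;
  compA : forall X Y Z W (h : catHom Z W) (g : catHom Y Z) (f : catHom X Y),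
    catComp h (catComp g f) = catComp (catComp h g) f }.

Record finalObject (C : category) := FinalObject {
  final_ob :> C;
  bang : forall X : C, catHom X final_ob;
  bang_uniq : forall (X : C) (f : catHom X final_ob), f = bang X }.

Record bifunctor (C : category) := Bifunctor {
  bif :> C -> zmodType;
  push : forall X Y : C, catHom X Y -> {additive bif X -> bif Y};
  pull : forall X Y : C, catHom X Y -> {additive bif Y -> bif X};
  push_id : forall (X : C) (a : bif X), push (catId X) a = a;
  push_comp : forall (X Y Z : C) (g : catHom Y Z) (f : catHom X Y) (a : bif X),
    push (catComp g f) a = push g (push f a);
  pull_id : forall (X : C) (a : bif X), pull (catId X) a = a;
  pull_comp : forall (X Y Z : C) (g : catHom Y Z) (f : catHom X Y) (a : bif Z),
    pull (catComp g f) a = pull f (pull g a) }.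

(* A commutative ring structure with additive group [V]; 1 = 0 is allowed. *)
Record comRingOn (V : zmodType) := ComRingOn {
  cr_one : V;
  cr_mul : V -> V -> V;
  cr_mulA : associative cr_mul;
  cr_mulC : commutative cr_mul;
  cr_mul1 : left_id cr_one cr_mul;
  cr_mulDl : left_distributive cr_mul +%R }.

Definition ringOf (V : zmodType) (m : comRingOn V) : Type := V.

HB.instance Definition _ (V : zmodType) (m : comRingOn V) :=
  GRing.Zmodule.on (ringOf m).
HB.instance Definition _ (V : zmodType) (m : comRingOn V) :=
  GRing.Zmodule_isComPzRing.Build (ringOf m)
    (cr_mulA m) (cr_mulC m) (cr_mul1 m) (cr_mulDl m).

Definition fchar (C : category) (pt : finalObject C) (F : bifunctor C)
    (m : comRingOn (F pt)) (X : C) : {additive F X -> ringOf m} :=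
  push F (bang pt X).
Arguments fchar {C pt F} m {X}.

Record directedSet (d : Order.disp_t) := DirectedSet {
  dset :> preorderType d;
  dset_inhabited : inhabited dset;
  dset_ub : forall l m : dset, exists n : dset, (l <= n)%O /\ (m <= n)%O }.

Record directSystem d (L : directedSet d) := DirectSystem {
  ds_ob :> L -> zmodType;
  ds_map : forall l m : L, (l <= m)%O -> {additive ds_ob l -> ds_ob m};
  ds_map_id : forall (l : L) (h : (l <= l)%O) (a : ds_ob l), ds_map h a = a;
  ds_map_comp : forall (l m n : L) (h1 : (l <= m)%O) (h2 : (m <= n)%O)
      (h : (l <= n)%O) (a : ds_ob l),
    ds_map h a = ds_map h2 (ds_map h1 a) }.

Section DirectLimit.
Variables (d : Order.disp_t) (L : directedSet d) (D : directSystem L).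

Let T := {l : L & D l}.

(* (l, a) and (m, b) are identified when their images in some D n agree. *)
Definition dl_rel (x y : T) : Prop :=
  exists (n : L) (h1 : (tag x <= n)%O) (h2 : (tag y <= n)%O),
    ds_map D h1 (tagged x) = ds_map D h2 (tagged y).
Definition dl_relb : rel T := fun x y => `[< dl_rel x y >].

Lemma dl_rel_raise (x y : T) (n p : L) (h1 : (tag x <= n)%O)
    (h2 : (tag y <= n)%O) (k1 : (tag x <= p)%O) (k2 : (tag y <= p)%O) :
  (n <= p)%O -> ds_map D h1 (tagged x) = ds_map D h2 (tagged y) ->
  ds_map D k1 (tagged x) = ds_map D k2 (tagged y).
Proof. by move=> np e; rewrite (ds_map_comp h1 np) e -(ds_map_comp h2 np). Qed.

Lemma dl_relb_refl : reflexive dl_relb.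
Proof. by move=> x; apply/asboolP; exists (tag x), (lexx _), (lexx _). Qed.

Lemma dl_relb_sym : symmetric dl_relb.
Proof.
by move=> x y; apply/asboolP/asboolP => -[n [h1 [h2 e]]]; exists n, h2, h1.
Qed.

Lemma dl_relb_trans : transitive dl_relb.
Proof.
move=> y x z /asboolP[n [h1 [h2 e]]] /asboolP[p [k1 [k2 f]]].
have [q [nq pq]] := dset_ub n p; apply/asboolP.
exists q, (le_trans h1 nq), (le_trans k2 pq).
rewrite (dl_rel_raise (le_trans h1 nq) (le_trans h2 nq) nq e).
exact: (dl_rel_raise _ _ pq f).
Qed.

Canonical dl_equiv :=
  EquivRel dl_relb dl_relb_refl dl_relb_sym dl_relb_trans.

Definition dirLim := {eq_quot dl_relb}.
HB.instance Definition _ := Choice.on dirLim.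
HB.instance Definition _ : EqQuotient _ dl_relb dirLim := EqQuotient.on dirLim.

Definition dl_in_def (l : L) (a : D l) : dirLim :=
  \pi_dirLim (Tagged (fun l : L => D l : Type) a).

Lemma dl_in_eq (l m : L) (a : D l) (b : D m) (n : L) (h1 : (l <= n)%O)
    (h2 : (m <= n)%O) :
  ds_map D h1 a = ds_map D h2 b -> dl_in_def a = dl_in_def b.
Proof. by move=> e; apply/eqmodP/asboolP; exists n, h1, h2. Qed.

Lemma dl_in_map (l m : L) (h : (l <= m)%O) (a : D l) :
  dl_in_def (ds_map D h a) = dl_in_def a.
Proof. by apply: (dl_in_eq (h1 := lexx m) (h2 := h)); rewrite ds_map_id. Qed.

Let ubw (l m : L) : {n : L | (l <= n)%O /\ (m <= n)%O} := cid (dset_ub l m).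
Let ub l m := sval (ubw l m).
Let ubl l m : (l <= ub l m)%O := (svalP (ubw l m)).1.
Let ubr l m : (m <= ub l m)%O := (svalP (ubw l m)).2.

Definition dl_add (u v : dirLim) : dirLim :=
  dl_in_def (ds_map D (ubl (tag (repr u)) (tag (repr v))) (tagged (repr u))
             + ds_map D (ubr (tag (repr u)) (tag (repr v))) (tagged (repr v))).
Definition dl_opp (u : dirLim) : dirLim := dl_in_def (- tagged (repr u)).
Definition dl_zero : dirLim :=
  dl_in_def (0 : D (inhabited_witness (dset_inhabited L))).

Lemma dl_surj (u : dirLim) : exists (l : L) (a : D l), u = dl_in_def a.
Proof.
by exists (tag (repr u)), (tagged (repr u)); rewrite /dl_in_def taggedK reprK.
Qed.

Lemma dl_repr (l : L) (a : D l) :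
  dl_rel (repr (dl_in_def a)) (Tagged (fun l : L => D l : Type) a).
Proof.
have /asboolP :
    dl_relb (repr (dl_in_def a)) (Tagged (fun l : L => D l : Type) a).
  by apply/eqmodP; rewrite reprK.
exact.
Qed.

Lemma dl_addE (l m n : L) (h1 : (l <= n)%O) (h2 : (m <= n)%O)
    (a : D l) (b : D m) :
  dl_add (dl_in_def a) (dl_in_def b)
  = dl_in_def (ds_map D h1 a + ds_map D h2 b).
Proof.
rewrite /dl_add; have := dl_repr a; have := dl_repr b.
case: (repr (dl_in_def a)) => l' a'; case: (repr (dl_in_def b)) => m' b' /=.
move=> [q [q1 [q2 /= f]]] [p [p1 [p2 /= e]]].
have [r [pr qr]] := dset_ub p q.
have [s [rs us]] := dset_ub r (ub l' m').
have [t [st nt]] := dset_ub s n.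
have pt := le_trans pr (le_trans rs st).
have qt := le_trans qr (le_trans rs st).
have ut := le_trans us st.
apply: (dl_in_eq (h1 := ut) (h2 := nt)); rewrite !raddfD.
rewrite -(ds_map_comp _ _ (le_trans (ubl l' m') ut)).
rewrite -(ds_map_comp _ _ (le_trans (ubr l' m') ut)).
rewrite -(ds_map_comp _ _ (le_trans h1 nt)) -(ds_map_comp _ _ (le_trans h2 nt)).
congr (_ + _).
  exact: (@dl_rel_raise (existT _ l' a') (existT _ l a) p t p1 p2 _ _ pt e).
exact: (@dl_rel_raise (existT _ m' b') (existT _ m b) q t q1 q2 _ _ qt f).
Qed.

Lemma dl_common (l m : L) (a : D l) (b : D m) : exists (n : L) (a' b' : D n),
  dl_in_def a = dl_in_def a' /\ dl_in_def b = dl_in_def b'.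
Proof.
by have [n [h1 h2]] := dset_ub l m;
  exists n, (ds_map D h1 a), (ds_map D h2 b); rewrite !dl_in_map.
Qed.

Lemma dl_addEs (l : L) (a b : D l) :
  dl_add (dl_in_def a) (dl_in_def b) = dl_in_def (a + b).
Proof. by rewrite (dl_addE (lexx l) (lexx l)) !ds_map_id. Qed.

Lemma dl_oppE (l : L) (a : D l) : dl_opp (dl_in_def a) = dl_in_def (- a).
Proof.
rewrite /dl_opp; have [n [h1 [h2 e]]] := dl_repr a.
by apply: (dl_in_eq (h1 := h1) (h2 := h2)); rewrite !raddfN e.
Qed.

Lemma dl_zeroE (l : L) : dl_zero = dl_in_def (0 : D l).
Proof.
rewrite /dl_zero.
have [n [h1 h2]] := dset_ub (inhabited_witness (dset_inhabited L)) l.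
by apply: (dl_in_eq (h1 := h1) (h2 := h2)); rewrite !raddf0.
Qed.

Lemma dl_addC : commutative dl_add.
Proof.
move=> u v; have [l [a ->]] := dl_surj u; have [m [b ->]] := dl_surj v.
by have [n [a' [b' [-> ->]]]] := dl_common a b; rewrite !dl_addEs addrC.
Qed.

Lemma dl_addA : associative dl_add.
Proof.
move=> u v w; have [l [a ->]] := dl_surj u; have [m [b ->]] := dl_surj v.
have [p [c ->]] := dl_surj w; have [n [a' [b' [-> ->]]]] := dl_common a b.
have [q [h1 h2]] := dset_ub n p.
rewrite -(dl_in_map h1 a') -(dl_in_map h1 b') -(dl_in_map h2 c).
by rewrite !dl_addEs addrA.
Qed.

Lemma dl_add0 : left_id dl_zero dl_add.
Proof.
by move=> u; have [l [a ->]] := dl_surj u; rewrite (dl_zeroE l) dl_addEs add0r.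
Qed.

Lemma dl_addN : left_inverse dl_zero dl_opp dl_add.
Proof.
move=> u; have [l [a ->]] := dl_surj u.
by rewrite dl_oppE dl_addEs addNr (dl_zeroE l).
Qed.

HB.instance Definition _ :=
  GRing.isZmodule.Build dirLim dl_addA dl_addC dl_add0 dl_addN.

Definition dl_in (l : L) (a : D l) : dirLim := dl_in_def a.
Arguments dl_in : clear implicits.

Lemma dl_in_zmod_morphism (l : L) : zmod_morphism (dl_in l).
Proof. by move=> a b; rewrite /dl_in -dl_addEs -dl_oppE. Qed.
End DirectLimit.

Arguments dl_in {d L} D l a.

HB.instance Definition _ d (L : directedSet d) (D : directSystem L) (l : L) :=
  GRing.isZmodMorphism.Build (D l) (dirLim D) (dl_in D l)
    (@dl_in_zmod_morphism d L D l).

Record multSet (R : comPzRingType) := MultSet {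
  ms_mem :> R -> Prop;
  ms1 : ms_mem 1;
  msM : forall a b : R, ms_mem a -> ms_mem b -> ms_mem (a * b) }.

Section Localization.
Variables (R : comPzRingType) (S : multSet R).

Definition locDen : Type := {s : R | `[< S s >]}.
HB.instance Definition _ := Choice.on locDen.

Definition mkDen (s : R) (hs : S s) : locDen := exist _ s (asboolT hs).

Lemma locDenP (s : locDen) : S (val s).
Proof. exact/asboolP/(valP s). Qed.

Let T : Type := (R * locDen)%type.

(* The factor u is needed because [R] may have zero divisors; if 0 is in [S],
   the ring of fractions is the zero ring. *)
Definition loc_rel (x y : T) : Prop :=
  exists2 u : R, S u & u * (x.1 * val y.2) = u * (y.1 * val x.2).
Definition loc_relb : rel T := fun x y => `[< loc_rel x y >].

Lemma loc_relb_refl : reflexive loc_relb.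
Proof. by move=> x; apply/asboolP; exists 1 => //; exact: ms1. Qed.

Lemma loc_relb_sym : symmetric loc_relb.
Proof. by move=> x y; apply/asboolP/asboolP => -[u Su e]; exists u. Qed.

Lemma loc_relb_trans : transitive loc_relb.
Proof.
move=> y x z /asboolP[u Su e] /asboolP[v Sv f]; apply/asboolP.
exists (u * v * val y.2).
  by apply: msM; [exact: msM | exact: locDenP].
transitivity (u * (x.1 * val y.2) * (v * val z.2)); first by ring.
rewrite e; transitivity (v * (y.1 * val z.2) * (u * val x.2)); first by ring.
by rewrite f; ring.
Qed.

Canonical loc_equiv :=
  EquivRel loc_relb loc_relb_refl loc_relb_sym loc_relb_trans.

Definition loc : Type := {eq_quot loc_relb}.
HB.instance Definition _ := Choice.on loc.
HB.instance Definition _ : EqQuotient _ loc_relb loc := EqQuotient.on loc.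

Definition locFrac (a : R) (s : locDen) : loc := \pi_loc (a, s).

Lemma locFracP (a b : R) (s t : locDen) :
  locFrac a s = locFrac b t <->
  exists2 u : R, S u & u * (a * val t) = u * (b * val s).
Proof.
split=> [/eqmodP /asboolP //|h].
by apply/eqmodP/asboolP.
Qed.

Lemma locFrac_surj (x : loc) : exists (a : R) (s : locDen), x = locFrac a s.
Proof.
by exists (repr x).1, (repr x).2; rewrite /locFrac -surjective_pairing reprK.
Qed.

Definition den1 : locDen := mkDen (ms1 S).
Definition denM (s t : locDen) : locDen := mkDen (msM (locDenP s) (locDenP t)).

Lemma denME (s t : locDen) : val (denM s t) = val s * val t.
Proof. by []. Qed.
Lemma den1E : val den1 = 1. Proof. by []. Qed.
Definition denE := (denME, den1E).

Definition loc_add (x y : loc) : loc :=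
  let: (a, s) := repr x in let: (b, t) := repr y in
  locFrac (a * val t + b * val s) (denM s t).
Definition loc_mul (x y : loc) : loc :=
  let: (a, s) := repr x in let: (b, t) := repr y in locFrac (a * b) (denM s t).
Definition loc_opp (x : loc) : loc := let: (a, s) := repr x in locFrac (- a) s.

Lemma loc_repr (a : R) (s : locDen) : exists (b : R) (t : locDen),
  repr (locFrac a s) = (b, t) /\
    exists2 u : R, S u & u * (b * val s) = u * (a * val t).
Proof.
exists (repr (locFrac a s)).1, (repr (locFrac a s)).2.
split; first by case: (repr _).
by apply/locFracP; rewrite /locFrac -surjective_pairing reprK.
Qed.

Lemma loc_addE (a b : R) (s t : locDen) :
  loc_add (locFrac a s) (locFrac b t)
  = locFrac (a * val t + b * val s) (denM s t).
Proof.
rewrite /loc_add; have [a' [s' [-> [u Su e]]]] := loc_repr a s.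
have [b' [t' [-> [v Sv f]]]] := loc_repr b t.
apply/locFracP; exists (u * v); [exact: msM | rewrite !denE].
transitivity (v * val t' * val t * (u * (a' * val s))
  + u * val s * val s' * (v * (b' * val t))); first by ring.
by rewrite e f; ring.
Qed.

Lemma loc_mulE (a b : R) (s t : locDen) :
  loc_mul (locFrac a s) (locFrac b t) = locFrac (a * b) (denM s t).
Proof.
rewrite /loc_mul; have [a' [s' [-> [u Su e]]]] := loc_repr a s.
have [b' [t' [-> [v Sv f]]]] := loc_repr b t.
apply/locFracP; exists (u * v); [exact: msM | rewrite !denE].
transitivity ((u * (a' * val s)) * (v * (b' * val t))); first by ring.
by rewrite e f; ring.
Qed.

Lemma loc_oppE (a : R) (s : locDen) : loc_opp (locFrac a s) = locFrac (- a) s.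
Proof.
rewrite /loc_opp; have [a' [s' [-> [u Su e]]]] := loc_repr a s.
by apply/locFracP; exists u => //; rewrite !mulNr !mulrN e.
Qed.

Lemma locFrac_eq (a b : R) (s t : locDen) :
  a * val t = b * val s -> locFrac a s = locFrac b t.
Proof. by move=> e; apply/locFracP; exists 1; [exact: ms1 | rewrite e]. Qed.

Lemma loc_addA : associative loc_add.
Proof.
move=> x y z; have [a [s ->]] := locFrac_surj x.
have [b [t ->]] := locFrac_surj y.
have [c [r ->]] := locFrac_surj z.
by rewrite !loc_addE; apply: locFrac_eq; rewrite ?denE; ring.
Qed.

Lemma loc_addC : commutative loc_add.
Proof.
move=> x y; have [a [s ->]] := locFrac_surj x.
have [b [t ->]] := locFrac_surj y.
by rewrite !loc_addE; apply: locFrac_eq; rewrite ?denE; ring.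
Qed.

Lemma loc_add0 : left_id (locFrac 0 den1) loc_add.
Proof.
move=> x; have [a [s ->]] := locFrac_surj x.
by rewrite !loc_addE; apply: locFrac_eq; rewrite ?denE; ring.
Qed.

Lemma loc_addN : left_inverse (locFrac 0 den1) loc_opp loc_add.
Proof.
move=> x; have [a [s ->]] := locFrac_surj x.
by rewrite loc_oppE !loc_addE; apply: locFrac_eq; rewrite ?denE; ring.
Qed.

HB.instance Definition _ :=
  GRing.isZmodule.Build loc loc_addA loc_addC loc_add0 loc_addN.

Lemma loc_mulA : associative loc_mul.
Proof.
move=> x y z; have [a [s ->]] := locFrac_surj x.
have [b [t ->]] := locFrac_surj y.
have [c [r ->]] := locFrac_surj z.
by rewrite !loc_mulE; apply: locFrac_eq; rewrite ?denE; ring.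
Qed.

Lemma loc_mulC : commutative loc_mul.
Proof.
move=> x y; have [a [s ->]] := locFrac_surj x.
have [b [t ->]] := locFrac_surj y.
by rewrite !loc_mulE; apply: locFrac_eq; rewrite ?denE; ring.
Qed.

Lemma loc_mul1 : left_id (locFrac 1 den1) loc_mul.
Proof.
move=> x; have [a [s ->]] := locFrac_surj x.
by rewrite !loc_mulE; apply: locFrac_eq; rewrite ?denE; ring.
Qed.

Lemma loc_mulDl : left_distributive loc_mul loc_add.
Proof.
move=> x y z; have [a [s ->]] := locFrac_surj x.
have [b [t ->]] := locFrac_surj y.
have [c [r ->]] := locFrac_surj z; rewrite !(loc_mulE, loc_addE).
by apply: locFrac_eq; rewrite ?denE; ring.
Qed.

HB.instance Definition _ := GRing.Zmodule_isComPzRing.Build loc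
  loc_mulA loc_mulC loc_mul1 loc_mulDl.

End Localization.

Section Powers.
Variable R : comPzRingType.

Definition prodOfPowers_mem (A : R -> Prop) (x : R) : Prop :=
  exists s : seq (R * nat),
    (forall a, a \in s -> A a.1) /\ x = \prod_(a <- s) a.1 ^+ a.2.

Lemma prodOfPowers1 A : prodOfPowers_mem A 1.
Proof. by exists [::]; rewrite big_nil. Qed.

Lemma prodOfPowersM A x y :
  prodOfPowers_mem A x -> prodOfPowers_mem A y -> prodOfPowers_mem A (x * y).
Proof.
move=> [s [hs ->]] [t [ht ->]]; exists (s ++ t); rewrite big_cat; split=> // a.
by rewrite mem_cat => /orP[/hs|/ht].
Qed.

Definition prodOfPowers (A : R -> Prop) : multSet R :=
  MultSet (prodOfPowers1 A) (@prodOfPowersM A).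

Definition powers_mem (p x : R) : Prop := exists k : nat, x = p ^+ k.

Lemma powers1 p : powers_mem p 1. Proof. by exists 0%N. Qed.

Lemma powersM p x y : powers_mem p x -> powers_mem p y -> powers_mem p (x * y).
Proof. by move=> [j ->] [k ->]; exists (j + k)%N; rewrite exprD. Qed.

Definition powers (p : R) : multSet R := MultSet (powers1 p) (@powersM p).

Lemma powers_pow (p : R) (k : nat) : powers p (p ^+ k).
Proof. by exists k. Qed.

End Powers.

(* Transition maps are indexed by l <= m, the one for l = m being the identity;
   on a poset this is the same as giving them for l < m only. *)
Record proSystem (C : category) d (L : directedSet d) := ProSystem {
  ps_ob :> L -> C;
  ps_map : forall l m : L, (l <= m)%O -> catHom (ps_ob m) (ps_ob l);
  ps_map_id : forall (l : L) (h : (l <= l)%O), ps_map h = catId (ps_ob l);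
  ps_map_comp : forall (l m n : L) (h1 : (l <= m)%O) (h2 : (m <= n)%O)
    (h : (l <= n)%O), catComp (ps_map h1) (ps_map h2) = ps_map h }.

(* Only the values [es_elt l m] with l <= m are meaningful. *)
Record elemSystem (R : comPzRingType) d (L : directedSet d) := ElemSystem {
  es_elt :> L -> L -> R;
  es1 : forall l : L, es_elt l l = 1;
  esM : forall l m n : L, (l <= m)%O -> (m <= n)%O ->
    es_elt l m * es_elt m n = es_elt l n }.

Definition elemOf (R : comPzRingType) d (L : directedSet d)
    (P : elemSystem R L) (x : R) : Prop :=
  exists l m : L, (l <= m)%O /\ x = P l m.

Definition nonzeroSystem (R : comPzRingType) d (L : directedSet d)
    (P : elemSystem R L) : Prop :=
  forall l m : L, (l <= m)%O -> P l m != 0.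

Section MulSystem.
Variables (R : comPzRingType) (d : Order.disp_t) (L : directedSet d).
Variable P : elemSystem R L.

Definition mulMap (l m : L) (h : (l <= m)%O) : {additive R -> R} :=
  P l m \*o idfun.

Lemma mulMap_id (l : L) (h : (l <= l)%O) (a : R) : mulMap h a = a.
Proof. by rewrite /= es1 mul1r. Qed.

Lemma mulMap_comp (l m n : L) (h1 : (l <= m)%O) (h2 : (m <= n)%O)
  (h : (l <= n)%O) (a : R) : mulMap h a = mulMap h2 (mulMap h1 a).
Proof. by rewrite /= mulrA -(esM P h1 h2) [P m n * _]mulrC. Qed.

Definition mulSystem : directSystem L :=
  DirectSystem (ds_ob := fun=> R) mulMap_id mulMap_comp.

End MulSystem.

Section Stable.
Variables (C : category) (pt : finalObject C) (F : bifunctor C).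
Variables (m : comRingOn (F pt)) (d : Order.disp_t) (L : directedSet d).
Variables (X : proSystem C L) (P : elemSystem (ringOf m) L).

(* For k = l the condition is trivial. *)
Definition stable_prop (l : L) (a : F (X l)) : Prop :=
  forall (k : L) (h : (l <= k)%O),
    fchar m (pull F (ps_map X h) a) = P l k * fchar m a.
Definition stable_pred (l : L) : {pred F (X l)} :=
  [pred a | `[< stable_prop a >]].
Arguments stable_pred : clear implicits.

Lemma stable_zmod_closed (l : L) : zmod_closed (stable_pred l).
Proof.
split=> [|a b]; rewrite !inE.
  by apply/asboolP => k h; rewrite !raddf0 mulr0.
move=> /asboolP ha /asboolP hb; apply/asboolP => k h.
by rewrite !raddfB mulrBr ha hb.
Qed.
HB.instance Definition _ (l : L) :=
  GRing.isZmodClosed.Build (F (X l)) (stable_pred l) (stable_zmod_closed l).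

Definition stable (l : L) : Type := {a : F (X l) | stable_pred l a}.
HB.instance Definition _ (l : L) := SubChoice.on (stable l).
HB.instance Definition _ (l : L) := [SubChoice_isSubZmodule of stable l by <:].

Lemma stable_pull (l k : L) (h : (l <= k)%O) (a : stable l) :
  stable_pred k (pull F (ps_map X h) (val a)).
Proof.
have /asboolP ha := valP a; apply/asboolP => n h'.
rewrite -pull_comp (ps_map_comp _ _ _ (le_trans h h')) !ha.
by rewrite mulrA [P k n * _]mulrC esM.
Qed.

Definition stableMap (l k : L) (h : (l <= k)%O) (a : stable l) : stable k :=
  exist _ (pull F (ps_map X h) (val a)) (stable_pull h a).

Lemma stableMap_zmod_morphism (l k : L) (h : (l <= k)%O) :
  zmod_morphism (stableMap h).
Proof. by move=> a b; apply: val_inj; rewrite /= !raddfB. Qed.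
HB.instance Definition _ (l k : L) (h : (l <= k)%O) :=
  GRing.isZmodMorphism.Build (stable l) (stable k) (stableMap h)
    (stableMap_zmod_morphism h).

Lemma stableMap_id (l : L) (h : (l <= l)%O) (a : stable l) : stableMap h a = a.
Proof. by apply: val_inj; rewrite /= ps_map_id pull_id. Qed.

Lemma stableMap_comp (l k n : L) (h1 : (l <= k)%O) (h2 : (k <= n)%O)
  (h : (l <= n)%O) (a : stable l) :
  stableMap h a = stableMap h2 (stableMap h1 a).
Proof. by apply: val_inj; rewrite /= -(ps_map_comp _ h1 h2) pull_comp. Qed.

Definition stableSystem : directSystem L :=
  DirectSystem (ds_ob := fun l => stable l : zmodType)
    stableMap_id stableMap_comp.

End Stable.

(* The directed set N = {1, 2, 3, ...}. *)
Definition posn : Type := {n : nat | (0 < n)%N}.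
HB.instance Definition _ := SubChoice.on posn.
HB.instance Definition _ := 
  [SubChoice_isSubOrder of posn by <: with Order.NatOrder.nat_display].

Definition pn (k : nat) : posn := exist _ k.+1 isT.

Lemma posn_ub (l m : posn) : exists n : posn, (l <= n)%O /\ (m <= n)%O.
Proof. by exists (Order.max l m); rewrite !le_max !lexx orbT. Qed.

Definition posnDS : directedSet _ := DirectedSet (inhabits (pn 0)) posn_ub.

Section Denominators.
Variables (R : comPzRingType) (P : elemSystem R posnDS).

(* p_{k(k+1)}, with the convention p_{01} := 1. *)
Definition stepElt (k : nat) : R :=
  if k is j.+1 then P (pn j) (pn j.+1) else 1.

(* p_{01} p_{12} ... p_{(n-1)n} *)
Definition stepProd (n : posn) : R := \prod_(k < val n) stepElt k.

Definition fracSet : multSet R := prodOfPowers (elemOf P).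

Lemma stepProd_mem (n : posn) : fracSet (stepProd n).
Proof.
rewrite /stepProd; elim/big_rec: _ => [|[[|k] /= _] x _ hx]; first exact: ms1.
  by rewrite mul1r.
apply: (@msM _ fracSet) => //; exists [:: (P (pn k) (pn k.+1), 1%N)].
rewrite big_seq1 expr1; split=> // a; rewrite inE => /eqP -> /=.
by exists (pn k), (pn k.+1); split; first exact: (leqnSn k.+1).
Qed.

Definition stepDen (n : posn) : locDen fracSet := mkDen (stepProd_mem n).

End Denominators.

Definition powDen (R : comPzRingType) (p : R) (k : nat) : locDen (powers p) :=
  mkDen (powers_pow p k).

(* Main.v *)
(* A compatible family of homomorphisms descends to the direct limit.  Stability
   is exactly compatibility of chi_F with multiplication by the p_{lm}, while
   p_{01} ... p_{(m-1)m} = p_{01} ... p_{(n-1)n} p_{nm} (and p^{m-1} =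
   p^{n-1} p^{m-n}) makes the maps r |-> r / (p_{01} ... p_{(n-1)n}) compatible
   with it. *)
Require Import Defs.
From HB Require Import structures.
From mathcomp Require Import all_boot all_order all_algebra.
From mathcomp Require Import boolp ring.

Set Implicit Arguments.
Unset Strict Implicit.
Unset Printing Implicit Defensive.

Import Order.Theory GRing.Theory.
Local Open Scope ring_scope.

Section DirectLimitDescent.
Variables (d : Order.disp_t) (L : directedSet d) (D : directSystem L).

(** Directedness carries two representatives to one index, so additivity on the limit can be checked
    inside a single [D l]. *)
Lemma dl_surj2 (u v : dirLim D) : exists (l : L) (a b : D l),
  u = dl_in D l a /\ v = dl_in D l b.
Proof.
have [l [a ->]] := dl_surj u; have [m [b ->]] := dl_surj v.
exact: dl_common.
Qed.

Lemma dl_desc (V : zmodType) (f : forall l : L, D l -> V) :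
    (forall l, zmod_morphism (f l)) ->
    (forall (l m : L) (h : (l <= m)%O) a, f m (ds_map D h a) = f l a) ->
  exists g : {additive dirLim D -> V}, forall l a, g (dl_in D l a) = f l a.
Proof.
move=> fB f_map; pose g (u : dirLim D) := f (tag (repr u)) (tagged (repr u)).
have gE l a : g (dl_in D l a) = f l a.
  (* The chosen representative of the class need only agree with [a] after transport to some [n];
     compatibility of [f] compares the two values there. *)
  have [n [h1 [h2 /= e]]] := dl_repr a.
  by rewrite -(f_map _ _ h2) -e f_map.
have gB : zmod_morphism g.
  by move=> u v; have [l [a [b [-> ->]]]] := dl_surj2 u v; rewrite -raddfB !gE fB.
pose gM := GRing.isZmodMorphism.Build _ _ g gB.
pose gA : {additive dirLim D -> V} := HB.pack g gM.
by exists gA.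
Qed.

End DirectLimitDescent.

(** Subtraction of fractions puts the result over [s * s], and one factor [s] cancels. *)
Lemma locFracB (R : comPzRingType) (S : multSet R) (s : locDen S) :
  zmod_morphism (@locFrac R S ^~ s).
Proof.
move=> a b; rewrite -[RHS]/(loc_add _ (loc_opp _)) loc_oppE loc_addE.
by apply: locFrac_eq; rewrite !denE mulNr -mulrBl mulrA.
Qed.

Lemma stepProdM (R : comPzRingType) (P : elemSystem R posnDS) (n m : posn) :
  (n <= m)%O -> stepProd P m = stepProd P n * P n m.
Proof.
(* Writing every index as [pn k] allows induction on natural numbers. *)
have pnE (k : posn) : k = pn (val k).-1.
  by apply: val_inj; case: k => [[]].
rewrite (pnE n) (pnE m); move: (val n).-1 (val m).-1 => {pnE}n {}m.
elim: m => [|m IHm] le_nm.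
  by case: n le_nm => // _; rewrite es1 mulr1.
have: (n <= m.+1)%N := le_nm.
rewrite leq_eqVlt => /predU1P[->|lt_nm]; first by rewrite es1 mulr1.
(* Since [pn m] is the integer m + 1, the last factor of the longer product is [stepElt P m.+1],
   never the conventional p_{01}. *)
have stepS : stepProd P (pn m.+1) = stepProd P (pn m) * P (pn m) (pn m.+1).
  by rewrite /stepProd /= big_ord_recr.
rewrite stepS IHm // -mulrA esM //; exact: leqnSn m.+1.
Qed.

(** Common source of (i), where [f l] is the canonical map of the [l]-th copy of the ring into the
    limit, and of (iii), where it is division by a power of [p]. *)
Lemma stableSystem_desc (C : category) (pt : finalObject C) (F : bifunctor C)
    (rg : comRingOn (F pt)) (d : Order.disp_t) (L : directedSet d)
    (X : proSystem C L) (P : elemSystem (ringOf rg) L) (V : zmodType)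
    (f : L -> ringOf rg -> V) :
    (forall l, zmod_morphism (f l)) ->
    (forall (l m : L) r, (l <= m)%O -> f m (P l m * r) = f l r) ->
  exists g : {additive dirLim (stableSystem X P) -> V},
    forall l (a : stable X P l),
      g (dl_in (stableSystem X P) l a) = f l (fchar rg (val a)).
Proof.
move=> fB f_mul.
apply: (@dl_desc _ _ (stableSystem X P) V (fun l a => f l (fchar rg (val a)))).
  by move=> l a b; rewrite !raddfB fB.
move=> l m h a; rewrite -(f_mul l m) //.
(* Stability of [a] at the index [m] turns the factor [P l m] into a pullback. *)
by have /asboolP/(_ m h) <- := valP a.
Qed.

Theorem theorem1p1 (C : category) (pt : finalObject C) (F : bifunctor C)
    (rg : comRingOn (F pt)) :
  (* (i) *)
  (forall (d : Order.disp_t) (L : directedSet d) (X : proSystem C L)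
      (P : elemSystem (ringOf rg) L), nonzeroSystem P ->
    exists chi_ind : {additive dirLim (stableSystem X P) ->
                               dirLim (mulSystem P)},
      forall (l : L) (a : stable X P l),
        chi_ind (dl_in (stableSystem X P) l a)
        = dl_in (mulSystem P) l (fchar rg (val a)))
  /\
  (* (ii) *)
  (forall (X : proSystem C posnDS) (P : elemSystem (ringOf rg) posnDS),
      nonzeroSystem P ->
    exists chi_ind : {additive dirLim (stableSystem X P) ->
                               dirLim (mulSystem P)},
    exists can : {additive dirLim (mulSystem P) -> loc (fracSet P)},
    exists chi_tilde : {additive dirLim (stableSystem X P) -> loc (fracSet P)},
      [/\ forall (n : posn) (a : stable X P n),
            chi_ind (dl_in (stableSystem X P) n a)
            = dl_in (mulSystem P) n (fchar rg (val a)),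
          forall (n : posn) (r : ringOf rg),
            can (dl_in (mulSystem P) n r) = locFrac r (stepDen P n),
          forall (n : posn) (a : stable X P n),
            chi_tilde (dl_in (stableSystem X P) n a)
            = locFrac (fchar rg (val a)) (stepDen P n)
        & forall x : dirLim (stableSystem X P), chi_tilde x = can (chi_ind x)])
  /\
  (* (iii) *)
  (forall (X : proSystem C posnDS) (p : ringOf rg)
      (P : elemSystem (ringOf rg) posnDS), p != 0 ->
      (forall n m : posn, (n <= m)%O -> P n m = p ^+ (val m - val n)) ->
    exists chi_tilde : {additive dirLim (stableSystem X P) -> loc (powers p)},
      forall (n : posn) (a : stable X P n),
        chi_tilde (dl_in (stableSystem X P) n a)
        = locFrac (fchar rg (val a)) (powDen p (val n).-1)).
Proof.
have ind d (L : directedSet d) (X : proSystem C L)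
    (P : elemSystem (ringOf rg) L) :
  exists chi_ind : {additive dirLim (stableSystem X P) -> dirLim (mulSystem P)},
    forall (l : L) (a : stable X P l),
      chi_ind (dl_in (stableSystem X P) l a)
      = dl_in (mulSystem P) l (fchar rg (val a)).
  apply: (@stableSystem_desc _ _ _ _ _ _ X P _ (dl_in (mulSystem P)))
    => [l|l m r h].
    exact: (@dl_in_zmod_morphism _ _ (mulSystem P) l).
  exact: (@dl_in_map _ _ (mulSystem P) l m h r).
split; first by move=> d L X P _; exact: ind.
split=> [X P _|X p P _ PE].
  have [chi chiE] := ind _ _ X P.
  have [can canE] :
      exists can : {additive dirLim (mulSystem P) -> loc (fracSet P)},
      forall n r, can (dl_in (mulSystem P) n r) = locFrac r (stepDen P n).
    apply: (@dl_desc _ _ (mulSystem P) _ (fun n r => locFrac r (stepDen P n))).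
      by move=> n; exact: locFracB.
    (* After cross-multiplication, what remains is the telescoping identity [stepProdM]. *)
    move=> n m h r; apply: locFrac_eq.
    by rewrite /= (stepProdM P h); ring.
  (* Taking the composite as [chi_tilde] makes the realization hold by definition; only its formula
     on classes is left. *)
  exists chi, can, (can \o chi); split=> // n a.
  by rewrite /= chiE canE.
apply: (@stableSystem_desc _ _ _ _ _ _ X P _
    (fun n r => locFrac r (powDen p (val n).-1))).
  by move=> n; exact: locFracB.
move=> n m r h; apply: locFrac_eq; rewrite /= PE // mulrAC -exprD mulrC.
(* The exponents satisfy (m - n) + (n - 1) = m - 1; truncated subtraction is exact here because 1 <=
   n <= m. *)
congr (_ * p ^+ _); case: n m h => [[|n] //= ?] [[|m] //= ?] h.
by rewrite subSS subnK.
Qed.
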